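(* Assume that, for each $v\in\{0,1\}$, the intersection of $\{x:U(x,v)=0\}$ with the invariant set of $F_v$ contains only the origin. Let $\{V^i(\cdot,\cdot)\}_{i\ge0}$ be generated by stabilizing action dependent value iteration and let $v^i(x)=\operatorname*{arg\,min}_{w\in\{0,1\}}V^i(x,w)$. For $r\in\mathbb{R}^+$ let the compact domain $\mathcal{B}_r^i$ be defined as $$\mathcal{B}_r^i:=\{x\in\mathbb{R}^n: V^i\big(x,v^i(x)\big)\le r\},$$ and let $\bar r^i>0$ be (the largest $r$) such that $\mathcal{B}^i_{\bar r^i}\subset\Omega$. Then, for every given $i\in\mathbb{N}$, the triggering policy $v^i(\cdot)$ asymptotically stabilizes the system about the origin (i.e. the origin is asymptotically stable for $x_{k+1}=F_{v^i(x_k)}(x_k)$), and $\mathcal{B}^i_{\bar r^i}$ is an estimation of the region of attraction for this system.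
   Context: Setting. A plant $x_{k+1}=f(x_k,u_k)$ has $f:\mathbb{R}^n\times\mathbb{R}^m\to\mathbb{R}^n$ continuous, $f(0,0)=0$, and a continuous control policy $h:\mathbb{R}^n\to\mathbb{R}^m$ is given, admissible in the sense that $h(0)=0$, $h$ asymptotically stabilizes $x_{k+1}=f(x_k,h(x_k))$ within the compact set $\Omega$, and $V_h(x_0):=\sum_{k=0}^\infty U(x_k^h,0)$ is continuous in $\Omega$, where $x_0^h=x_0$, $x_k^h=f(x_{k-1}^h,h(x_{k-1}^h))$. The switched system is $x_{k+1}=F_{v_k}(x_k)$, $v_k\in\{0,1\}$, with $F_0(x)=f(x,0)$ (network not used) and $F_1(x)=f(x,h(x))$ (network used). The infinite-horizon cost is $J=\sum_{k=0}^\infty U(x_k,v_k)$, where $U:\mathbb{R}^n\times\{0,1\}\to\mathbb{R}^+$ ($\mathbb{R}^+$ denotes the non-negative reals) is positive semi-definite and continuous in its first argument. $\mathbb{N}$ denotes the non-negative integers. Meaning of the invariant-set assumption: there is no set of states other than $\{0\}$ in which a trajectory can stay forever with zero running cost, i.e. without converging to the origin. A triggering policy is a map $w(\cdot)$ from states to $\{0,1\}$. Its action dependent value function is $V_w(x_0,v):=U(x_0,v)+\sum_{k=1}^\infty U(x_k^w,w(x_k^w))$, where $x_1^w:=F_v(x_0)$ and $x_k^w:=F_{w(x_{k-1}^w)}(x_{k-1}^w)$ for $k\ge2$. It is admissible if $V_w(\cdot,v)$ is continuous (hence bounded) in the compact set $\Omega$ for every $v\in\{0,1\}$. Stabilizing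 action dependent value iteration is the recursion $$V^{i+1}(x,v)=U(x,v)+\min_{w'\in\{0,1\}}V^i\big(F_v(x),w'\big),\quad\forall x,\ \forall v\in\{0,1\},$$ initiated with $V^0=V_w$, the action dependent value function of an admissible triggering policy $w(\cdot)$. An estimation of the region of attraction is a set of initial states from which every trajectory of the closed-loop system converges to the origin (a subset of the region of attraction).
   Formalization: The invariant-set assumption is taken for trajectories that may switch between modes, not for each F_v alone (otherwise a zero-cost switching cycle is a counterexample), and Ω is assumed to be a neighbourhood of the origin (Ω={0} is a counterexample). *)

(* Defs.v *)
(* MathComp-Analysis; the state and input spaces are row vectors over a
   realType. *)
From HB Require Import structures.
From mathcomp Require Import all_boot all_order all_algebra.
From mathcomp Require Import all_classical all_reals all_analysis.

Set Implicit Arguments.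
Unset Strict Implicit.
Unset Printing Implicit Defensive.

Import Order.TTheory GRing.Theory Num.Theory.
Import numFieldNormedType.Exports.

Local Open Scope classical_set_scope.
Local Open Scope ring_scope.

Definition roa_estimate (R : realType) (n : nat) (g : 'rV[R]_n -> 'rV[R]_n)
    (B : set 'rV[R]_n) : Prop :=
  forall x, B x -> iter k g x @[k --> \oo] --> (0 : 'rV[R]_n).

Definition lyapunov_stable (R : realType) (n : nat)
    (g : 'rV[R]_n -> 'rV[R]_n) : Prop :=
  forall e : R, 0 < e ->
    exists2 d : R, 0 < d &
      forall x : 'rV[R]_n, `|x| < d -> forall k : nat, `|iter k g x| < e.

Definition asymptotically_stable (R : realType) (n : nat)
    (g : 'rV[R]_n -> 'rV[R]_n) : Prop :=
  lyapunov_stable g /\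
  exists2 d : R, 0 < d & roa_estimate g [set x | `|x| < d].

(* Values live in \bar R because an infinite-horizon cost may diverge outside
   Omega; being continuous in Omega includes being finite there. *)
Definition continuous_value_on (R : realType) (n : nat)
    (Omega : set 'rV[R]_n) (V : 'rV[R]_n -> \bar R) : Prop :=
  (forall x, Omega x -> V x \is a fin_num) /\ {within Omega, continuous V}.

(* In {0,1}, [true] is 1 (network used) and [false] is 0. *)
Definition mode (R : realType) (n m : nat)
    (f : 'rV[R]_n -> 'rV[R]_m -> 'rV[R]_n) (h : 'rV[R]_n -> 'rV[R]_m)
    (v : bool) (x : 'rV[R]_n) : 'rV[R]_n :=
  if v then f x (h x) else f x 0.

(* The running cost is U(x_k, 0), although the network is used throughout. *)
Definition control_value (R : realType) (n m : nat)
    (f : 'rV[R]_n -> 'rV[R]_m -> 'rV[R]_n) (h : 'rV[R]_n -> 'rV[R]_m)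
    (U : 'rV[R]_n -> bool -> R) (x : 'rV[R]_n) : \bar R :=
  (\sum_(0 <= k <oo) (U (iter k (mode f h true) x) false)%:E)%E.

Definition admissible_control (R : realType) (n m : nat)
    (f : 'rV[R]_n -> 'rV[R]_m -> 'rV[R]_n) (U : 'rV[R]_n -> bool -> R)
    (Omega : set 'rV[R]_n) (h : 'rV[R]_n -> 'rV[R]_m) : Prop :=
  [/\ h 0 = 0,
      asymptotically_stable (mode f h true),
      roa_estimate (mode f h true) Omega &
      continuous_value_on Omega (control_value f h U)].

Definition running_cost (R : realType) (n : nat)
    (U : 'rV[R]_n -> bool -> R) : Prop :=
  [/\ forall x v, 0 <= U x v, forall v, U 0 v = 0 &
      forall v, continuous (U ^~ v)].

(* From every state of S, some choice of modes keeps the trajectory in S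
   forever at zero running cost. The mode may change along the trajectory:
   invariance under a single F_v would miss zero-cost cycles of the switched
   system. *)
Definition zero_cost_invariant (R : realType) (n : nat)
    (F : bool -> 'rV[R]_n -> 'rV[R]_n) (U : 'rV[R]_n -> bool -> R)
    (S : set 'rV[R]_n) : Prop :=
  forall x, S x -> exists v : bool, U x v = 0 /\ S (F v x).

Definition closed_loop (R : realType) (n : nat)
    (F : bool -> 'rV[R]_n -> 'rV[R]_n) (w : 'rV[R]_n -> bool)
    (x : 'rV[R]_n) : 'rV[R]_n :=
  F (w x) x.

(* The mode is v at time 0 and is given by the policy w from time 1 on. *)
Definition policy_traj (R : realType) (n : nat)
    (F : bool -> 'rV[R]_n -> 'rV[R]_n) (w : 'rV[R]_n -> bool)
    (x : 'rV[R]_n) (v : bool) (k : nat) : 'rV[R]_n :=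
  if k is j.+1 then iter j (closed_loop F w) (F v x) else x.

Definition policy_value (R : realType) (n : nat)
    (F : bool -> 'rV[R]_n -> 'rV[R]_n) (U : 'rV[R]_n -> bool -> R)
    (w : 'rV[R]_n -> bool) (x : 'rV[R]_n) (v : bool) : \bar R :=
  ((U x v)%:E + \sum_(1 <= k <oo)
      (U (policy_traj F w x v k) (w (policy_traj F w x v k)))%:E)%E.

Definition admissible_policy (R : realType) (n : nat)
    (F : bool -> 'rV[R]_n -> 'rV[R]_n) (U : 'rV[R]_n -> bool -> R)
    (Omega : set 'rV[R]_n) (w : 'rV[R]_n -> bool) : Prop :=
  forall v : bool, continuous_value_on Omega ((policy_value F U w) ^~ v).

Fixpoint value_iteration (R : realType) (n : nat)
    (F : bool -> 'rV[R]_n -> 'rV[R]_n) (U : 'rV[R]_n -> bool -> R)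
    (w : 'rV[R]_n -> bool) (i : nat) (x : 'rV[R]_n) (v : bool) : \bar R :=
  if i is j.+1 then
    ((U x v)%:E + Order.min (value_iteration F U w j (F v x) false)
                            (value_iteration F U w j (F v x) true))%E
  else policy_value F U w x v.

(* The argmin may be non-unique; any selection of minimizers is allowed. *)
Definition argmin_policy (R : realType) (n : nat)
    (V : 'rV[R]_n -> bool -> \bar R) (p : 'rV[R]_n -> bool) : Prop :=
  forall x v, (V x (p x) <= V x v)%E.

Definition value_sublevel (R : realType) (n : nat)
    (V : 'rV[R]_n -> bool -> \bar R) (p : 'rV[R]_n -> bool) (r : R) :
    set 'rV[R]_n :=
  [set x | (V x (p x) <= r%:E)%E].

(* Main.v *)
(* Let V^i denote the iterates, W^i x = min_v V^i x v and g the closed loop of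
   v^i. As V^i decreases with i, W^i (g x) + U x (v^i x) <= W^i x: W^i is a
   Lyapunov function, and its zero set is a zero-cost invariant set, hence {0}.
   The V^i with i > 0 need not be continuous on Omega, since F_v may leave
   Omega; but their sublevel sets are closed below the level r, because the
   sublevel sets of the earlier iterates at level r also lie in Omega. Closed
   sublevel sets and continuity of V^0 at 0 suffice for stability. For attraction
   the closed loop may be discontinuous, but along a subsequence converging to a
   cluster point one mode recurs, so the cluster set of a trajectory is a
   zero-cost invariant set. *)
Require Import Defs.
From HB Require Import structures.
From mathcomp Require Import all_boot all_order all_algebra.
From mathcomp Require Import all_classical all_reals all_analysis.
From mathcomp Require Import lra.
Import Order.TTheory GRing.Theory Num.Theory.
Import numFieldNormedType.Exports.
Local Open Scope classical_set_scope.
Local Open Scope ring_scope.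

(** * Continuity of the modes; Bellman equation and monotonicity of the iterates *)

Lemma continuous_mode {R : realType} {n m : nat}
    {f : 'rV[R]_n -> 'rV[R]_m -> 'rV[R]_n} {h : 'rV[R]_n -> 'rV[R]_m} v :
  continuous (fun p : 'rV[R]_n * 'rV[R]_m => f p.1 p.2) -> continuous h ->
  continuous (mode f h v).
Proof.
move=> f_cont h_cont x; case: v.
  apply: (@continuous2_cvg _ _ _ _ (nbhs x) _ id h f x (h x)).
  - exact: (f_cont (x, h x)).
  - exact: cvg_id.
  - exact: h_cont.
apply: (continuous_comp (f := fun y => (y, 0 : 'rV[R]_m))
  (g := fun p => f p.1 p.2)); last exact: f_cont.
exact: (@cvg_pair _ _ _ (nbhs x) (nbhs x) (nbhs (0 : 'rV[R]_m)) _ _ _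
  id (fun=> 0) cvg_id (cvg_cst _)).
Qed.

(** Bellman equation of the fixed policy [w]: from time 1 on, the trajectory is the one that starts
    at [F v x] in the mode chosen by [w]. *)
Lemma policy_value_rec {R : realType} {n : nat}
    {F : bool -> 'rV[R]_n -> 'rV[R]_n} {U : 'rV[R]_n -> bool -> R}
    {w : 'rV[R]_n -> bool} x v : (forall x v, 0 <= U x v) ->
  (policy_value F U w x v =
    (U x v)%:E + policy_value F U w (F v x) (w (F v x)))%E.
Proof.
move=> U_ge0; rewrite /policy_value; congr (_ + _)%E.
rewrite -nneseries_addn; last by move=> k; rewrite lee_fin.
rewrite nneseries_recl//; last by move=> k _; rewrite lee_fin.
rewrite addn1 /=; congr (_ + _)%E.
rewrite -[LHS]nneseries_addn; last by move=> k; rewrite lee_fin.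
rewrite -[RHS]nneseries_addn; last by move=> k; rewrite lee_fin.
by apply: eq_eseriesr => k _; rewrite !addn1 /= -iterS iterSr.
Qed.

Lemma policy_value_ge0 {R : realType} {n : nat}
    {F : bool -> 'rV[R]_n -> 'rV[R]_n} {U : 'rV[R]_n -> bool -> R}
    {w : 'rV[R]_n -> bool} x v : (forall x v, 0 <= U x v) ->
  (0 <= policy_value F U w x v)%E.
Proof.
move=> U_ge0; apply: adde_ge0; first by rewrite lee_fin.
by apply: nneseries_ge0 => k _ _; rewrite lee_fin.
Qed.

Lemma policy_value0 {R : realType} {n : nat}
    {F : bool -> 'rV[R]_n -> 'rV[R]_n} {U : 'rV[R]_n -> bool -> R}
    {w : 'rV[R]_n -> bool} v :
  (forall v, F v 0 = 0) -> (forall v, U 0 v = 0) ->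
  policy_value F U w 0 v = 0%E.
Proof.
move=> F0 U0; rewrite /policy_value U0 add0e.
have traj0 k : policy_traj F w 0 v k = 0.
  case: k => //= k; rewrite F0; elim: k => //= k ->; exact: F0.
rewrite (@eq_eseriesr _ _ (fun=> 0%E)); last by move=> k _; rewrite traj0 U0.
by rewrite eseries0.
Qed.

Lemma value_iteration_ge0 {R : realType} {n : nat}
    {F : bool -> 'rV[R]_n -> 'rV[R]_n} {U : 'rV[R]_n -> bool -> R}
    {w : 'rV[R]_n -> bool} i x v : (forall x v, 0 <= U x v) ->
  (0 <= value_iteration F U w i x v)%E.
Proof.
move=> U_ge0; elim: i x v => [|i IH] x v /=; first exact: policy_value_ge0.
by apply: adde_ge0; [rewrite lee_fin | rewrite le_min !IH].
Qed.

(** At the first step, the minimum over the next mode is at most the choice of [w] in the Bellman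
    equation of [policy_value]. Later steps follow because the Bellman operator is monotone. *)
Lemma value_iterationS_le {R : realType} {n : nat}
    {F : bool -> 'rV[R]_n -> 'rV[R]_n} {U : 'rV[R]_n -> bool -> R}
    {w : 'rV[R]_n -> bool} i x v : (forall x v, 0 <= U x v) ->
  (value_iteration F U w i.+1 x v <= value_iteration F U w i x v)%E.
Proof.
move=> U_ge0; elim: i x v => [|i IH] x v.
  rewrite /= [leRHS]policy_value_rec//; apply: leeD2l.
  by rewrite ge_min; case: (w _); rewrite lexx ?orbT.
apply: leeD2l; rewrite le_min; apply/andP; split.
  by rewrite ge_min; apply/orP; left; exact: IH.
by rewrite ge_min; apply/orP; right; exact: IH.
Qed.

Lemma value_iteration_le {R : realType} {n : nat}
    {F : bool -> 'rV[R]_n -> 'rV[R]_n} {U : 'rV[R]_n -> bool -> R}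
    {w : 'rV[R]_n -> bool} i x v : (forall x v, 0 <= U x v) ->
  (value_iteration F U w i x v <= policy_value F U w x v)%E.
Proof.
move=> U_ge0; elim: i => [//|i IH].
exact: le_trans (value_iterationS_le _ _ _ U_ge0) IH.
Qed.

(** Since [p] attains the minimum at the next state, the left side is at most the iterate [i.+1] at
    [(x, p x)], which is below the iterate [i]. *)
Lemma argmin_value_decrease {R : realType} {n : nat}
    {F : bool -> 'rV[R]_n -> 'rV[R]_n} {U : 'rV[R]_n -> bool -> R}
    {w p : 'rV[R]_n -> bool} {i} (V := value_iteration F U w i) x :
  (forall x v, 0 <= U x v) -> argmin_policy V p ->
  ((U x (p x))%:E + V (closed_loop F p x) (p (closed_loop F p x))
    <= V x (p x))%E.
Proof.
move=> U_ge0 p_argmin.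
apply: le_trans (value_iterationS_le _ _ _ U_ge0).
by apply: leeD2l; rewrite le_min !p_argmin.
Qed.

(** * Closedness of sublevel sets *)

Lemma closed_within_sublevel {R : realType} {T : topologicalType} {K : set T}
    {V : T -> \bar R} (s : \bar R) : closed K -> {within K, continuous V} ->
  [set x | (V x <= s)%E] `<=` K -> closed [set x | (V x <= s)%E].
Proof.
move=> K_closed /subspace_continuousP V_cont sK x clx.
have Kx : K x by apply: K_closed; exact: closure_subset clx.
rewrite /= leNgt; apply/negP => sV.
have near_gt : nbhs x (fun y => K y -> (s < V y)%E).
  have /(V_cont x Kx)// : nbhs (V x) [set y | (s < y)%E].
  by apply: open_nbhs_nbhs; split=> //; exact: open_ereal_gt_ereal.
have [y [/= Vy /(_ (sK _ Vy))]] := clx _ near_gt.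
by rewrite ltNge Vy.
Qed.

(* Writes a sublevel set of a sum of two functions through sublevel sets of the
   summands, with only levels [<= s] for the second one. *)
Lemma adde_le_splitP {R : realType} {u : R} {m : \bar R} (s : R) :
  0 <= u -> (0 <= m)%E ->
  (u%:E + m <= s%:E)%E <->
  (m <= s%:E)%E /\ forall q : R, 0 <= q -> u <= q \/ (m <= (s - q)%:E)%E.
Proof.
case: m => [m||] u0; rewrite ?leeNy_eq// ?lee_fin => m0; last first.
  by split=> [|[]]; rewrite ?addey// leye_eq.
split=> [um|[ms mq]].
  split=> [|q q0]; first by lra.
  by have [uq|qu] := leP u q; [left | right; rewrite lee_fin; lra].
rewrite leNgt; apply/negP => sum.
(* If [s < u + m], the midpoint of [s - m] and [u] lies strictly between them, so both alternatives
   fail; it is nonnegative because [m <= s]. *)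
by case: (mq ((u + (s - m)) / 2)); rewrite ?lee_fin; lra.
Qed.

(** Induction on [i]. The inclusion in [K] at level [r] passes down from [i.+1] to [i] because the
    iterates decrease; closedness passes up through preimages under the continuous [F v]. *)
Lemma closed_value_iteration_sublevel {R : realType} {n : nat}
    {F : bool -> 'rV[R]_n -> 'rV[R]_n} {U : 'rV[R]_n -> bool -> R}
    {K : set 'rV[R]_n} {w : 'rV[R]_n -> bool} {r : R} :
  (forall v, continuous (F v)) -> (forall v, continuous (U ^~ v)) ->
  (forall x v, 0 <= U x v) -> closed K -> admissible_policy F U K w ->
  forall i, (forall x v, (value_iteration F U w i x v <= r%:E)%E -> K x) ->
  forall v s, s <= r ->
  closed [set x | (value_iteration F U w i x v <= s%:E)%E].
Proof.
move=> F_cont U_cont U_ge0 K_closed w_adm; elim=> [|i IH] VK v s sr.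
  apply: (closed_within_sublevel _ K_closed (proj2 (w_adm v))) => x /= Vx.
  by apply: (VK x v); apply: le_trans Vx _; rewrite lee_fin.
set M := fun y => Order.min (value_iteration F U w i y false)
                            (value_iteration F U w i y true).
have M_closed t : t <= r -> closed [set x | (M (F v x) <= t%:E)%E].
  move=> tr; have := proj1 (continuous_closedP (F v)) (F_cont v)
    [set y | (M y <= t%:E)%E]; apply.
  rewrite (_ : [set y | _] =
      [set y | (value_iteration F U w i y false <= t%:E)%E] `|`
      [set y | (value_iteration F U w i y true <= t%:E)%E]); last first.
    by apply/seteqP; split=> y /=; rewrite ge_min => /orP.
  have VKi x u : (value_iteration F U w i x u <= r%:E)%E -> K x.
    move=> Vx; apply: (VK x u).
    exact: le_trans (value_iterationS_le _ _ _ U_ge0) Vx.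
  by apply: closedU; exact: IH.
have M_ge0 y : (0 <= M y)%E by rewrite le_min !value_iteration_ge0.
(* Only the levels [s] and [s - q] with [0 <= q] occur for [M]; all are at most [r], where
   closedness is available. *)
rewrite (_ : [set x | _] = [set x | (M (F v x) <= s%:E)%E] `&`
    \bigcap_(q in [set q : R | 0 <= q]) ([set x | U x v <= q] `|`
      [set x | (M (F v x) <= (s - q)%:E)%E])); last first.
  apply/seteqP; split=> x /=.
    by move=> /(adde_le_splitP s (U_ge0 x v) (M_ge0 (F v x))).
  by move=> VM; apply/(adde_le_splitP s (U_ge0 x v) (M_ge0 (F v x))).
apply: closedI; first exact: M_closed.
apply: closed_bigI => q /= q0; apply: closedU; last by apply: M_closed; lra.
have := proj1 (continuous_closedP (U ^~ v)) (U_cont v) _ (@closed_le R q).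
by apply.
Qed.

(** * Convergence of trajectories *)

(** The decrease of [W] telescopes: the partial sums of the costs are bounded by the finite [W x],
    so their series converges. *)
Lemma cvg_stage_cost0 {R : realType} {T : Type} {g : T -> T} {c : T -> R}
    {W : T -> \bar R} {x : T} :
  (forall y, 0 <= c y) -> (forall y, (0 <= W y)%E) ->
  (forall y, ((c y)%:E + W (g y) <= W y)%E) -> (W x < +oo)%E ->
  c (iter k g x) @[k --> \oo] --> 0.
Proof.
move=> c_ge0 W_ge0 W_decr Wx_fin.
apply: (@cvg_series_cvg_0 _ _ (fun k => c (iter k g x))).
apply: nondecreasing_is_cvgn.
  by apply/nondecreasing_seqP => k; rewrite seriesSr/= lerDl.
exists (fine (W x)) => _ [k _ <-].
have sum_le j : ((series (fun k => c (iter k g x)) j)%:E + W (iter j g x)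
    <= W x)%E.
  elim: j => [|j IH]; first by rewrite /series/= big_geq// add0e.
  rewrite seriesSr/= EFinD -addeA; apply: le_trans IH; apply: leeD2l.
  exact: W_decr.
rewrite -lee_fin fineK ?ge0_fin_numE//.
by apply: le_trans (sum_le k); rewrite leeDl.
Qed.

Lemma zero_cost_invariant_cluster {R : realType} {n : nat}
    {F : bool -> 'rV[R]_n -> 'rV[R]_n} {U : 'rV[R]_n -> bool -> R}
    {p : 'rV[R]_n -> bool} {x : 'rV[R]_n}
    (tr := fun k => iter k (closed_loop F p) x) :
  (forall v, continuous (F v)) -> (forall v, continuous (U ^~ v)) ->
  (forall x v, 0 <= U x v) -> U (tr k) (p (tr k)) @[k --> \oo] --> 0 ->
  zero_cost_invariant F U (cluster (tr @ \oo)).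
Proof.
move=> F_cont U_cont U_ge0 cost0 y yS.
(* Pigeonhole on the two modes: if each were eventually absent near [y], the trajectory could not
   return near [y] at late times. *)
have [v vP] : exists v, forall N, nbhs y N -> forall k0, exists k,
    [/\ (k0 <= k)%N, N (tr k) & p (tr k) = v].
  apply: contrapT => /forallNP noP.
  have bad v : exists N k0, nbhs y N /\
      forall k, (k0 <= k)%N -> N (tr k) -> p (tr k) <> v.
    have /existsNP[N /not_implyP[yN /existsNP[k0 k0P]]] := noP v.
    exists N, k0; split=> // k k0k Nk pk; apply: k0P; by exists k.
  have [N1 [k1 [yN1 P1]]] := bad true.
  have [N0 [k0 [yN0 P0]]] := bad false.
  have tail : (tr @ \oo) (tr @` [set k | (maxn k0 k1 <= k)%N]).
    by exists (maxn k0 k1) => // k /= kk; exists k.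
  have [_ [[k /= + <-] [N0k N1k]]] := yS _ _ tail (filterI yN0 yN1).
  rewrite geq_max => /andP[k0k k1k].
  by case: (p (tr k)) (P1 k k1k N1k) (P0 k k0k N0k).
exists v; split.
  apply/eqP; rewrite eq_le U_ge0 andbT leNgt; apply/negP => Uy_gt0.
  have yN : nbhs y [set z | U y v / 2 < U z v].
    have /(U_cont v y)// : nbhs (U y v) [set z | U y v / 2 < z].
    by apply: open_nbhs_nbhs; split; [exact: open_gt | rewrite /=; lra].
  have [k0 _ k0P] : \forall k \near \oo, U (tr k) (p (tr k)) < U y v / 2.
    have /cost0// : nbhs (0 : R) [set z | z < U y v / 2].
    by apply: open_nbhs_nbhs; split; [exact: open_lt | rewrite /=; lra].
  have [k [k0k /= Nk pk]] := vP _ yN k0.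
  by have := k0P k k0k; rewrite /= pk ltNge (ltW Nk).
(* [F v y] is again a cluster point: at late times when the trajectory is near [y] in mode [v], its
   next state is near [F v y]. *)
move=> A B [k0 _ k0A] /(F_cont v y) yB.
have [k [k0k Bk pk]] := vP _ yB k0.
exists (F v (tr k)); split=> //.
have -> : F v (tr k) = tr k.+1 by rewrite -pk.
by apply: k0A; rewrite /= leqW.
Qed.

(** A trajectory in the compact [K] has a nonempty cluster set, which is zero-cost invariant and
    hence equal to [[set 0]]; by compactness the trajectory converges to its only cluster point. *)
Lemma roa_of_stage_cost0 {R : realType} {n : nat}
    {F : bool -> 'rV[R]_n -> 'rV[R]_n} {U : 'rV[R]_n -> bool -> R}
    {p : 'rV[R]_n -> bool} {K : set 'rV[R]_n} (g := closed_loop F p) :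
  (forall v, continuous (F v)) -> (forall v, continuous (U ^~ v)) ->
  (forall x v, 0 <= U x v) ->
  (forall S, zero_cost_invariant F U S -> S `<=` [set 0]) ->
  compact K -> nbhs (0 : 'rV[R]_n) K -> (forall x, K x -> K (g x)) ->
  (forall x, K x -> U (iter k g x) (p (iter k g x)) @[k --> \oo] --> 0) ->
  roa_estimate g K.
Proof.
move=> F_cont U_cont U_ge0 only0 K_compact K_nbhs0 Kg cost0 x Kx.
have Ktr k : K (iter k g x) by elim: k => //= k; exact: Kg.
have trK : (iter k g x @[k --> \oo]) K by exists 0%N => // k _; exact: Ktr.
have sub0 : cluster (iter k g x @[k --> \oo]) `<=` [set 0].
  by apply: only0; apply: zero_cost_invariant_cluster => //; exact: cost0.
apply: (compact_cluster_set1 (@norm_hausdorff R _) K_compact) => //.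
apply/seteqP; split=> // _ ->.
by have [y [_ cly]] := K_compact _ _ trK; rewrite -(sub0 y cly).
Qed.

(** * Stability from a Lyapunov function with closed sublevel sets *)

Lemma lyapunov_stable_of_sublevels {R : realType} {n : nat}
    {g : 'rV[R]_n -> 'rV[R]_n} {W : 'rV[R]_n -> \bar R} {r : R} : 0 < r ->
  (forall s, s <= r -> closed [set x | (W x <= s%:E)%E]) ->
  compact [set x | (W x <= r%:E)%E] ->
  (forall s : R, 0 < s -> nbhs (0 : 'rV[R]_n) [set x | (W x <= s%:E)%E]) ->
  (forall x, (W (g x) <= W x)%E) -> (forall x, (W x <= 0)%E -> x = 0) ->
  lyapunov_stable g.
Proof.
move=> r0 W_closed W_compact W_nbhs0 W_decr W_def e e0.
(* Sublevel sets shrink to the origin: otherwise points [u k] of norm at least [e] with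
   [W (u k) <= r / k.+1] have a cluster point [y]. Closedness gives [W y <= 0], so [y = 0], against
   [e <= |y|]. *)
have [s s0 sP] : exists2 s : R, 0 < s &
    forall x, (W x <= s%:E)%E -> `|x| < e.
  apply: contrapT => noP.
  have /choice[u uP] : forall k, exists x,
      (W x <= (r * k.+1%:R^-1)%:E)%E /\ e <= `|x|.
    move=> k; apply: contrapT => /forallNP kP; apply: noP.
    exists (r * k.+1%:R^-1) => [|x Wx]; first by rewrite mulr_gt0.
    by rewrite ltNge; apply/negP => ex; apply: (kP x).
  have rk_le k l : (k <= l)%N -> r * l.+1%:R^-1 <= r * k.+1%:R^-1.
    by move=> kl; rewrite ler_pM2l// lef_pV2 ?posrE// ler_nat ltnS.
  have rk_r k : r * k.+1%:R^-1 <= r.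
    by have := rk_le 0 k (leq0n k); rewrite invr1 mulr1.
  have [|y [_ cly]] := W_compact (u @ \oo) _.
    by exists 0%N => // k _ /=; apply: le_trans (proj1 (uP k)) _;
      rewrite lee_fin.
  have Wy k : (W y <= (r * k.+1%:R^-1)%:E)%E.
    apply: (W_closed _ (rk_r k)) => N yN; apply: cly => //.
    exists k => // l /= kl; apply: le_trans (proj1 (uP l)) _.
    by rewrite lee_fin rk_le.
  have ey : e <= `|y|.
    apply: (proj1 (continuous_closedP _) (@norm_continuous _ 'rV[R]_n) _
      (@closed_ge R e)) => N yN; apply: cly => //.
    by exists 0%N => // k _; exact: (proj2 (uP k)).
  suff y0 : y = 0 by move: ey; rewrite y0 normr0 leNgt e0.
  apply: W_def; apply/lee_addgt0Pr => d d0; rewrite add0e.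
  (* With [k.+1^-1 < d / r], the bound [r / k.+1] on [W y] is below [d]. *)
  have [k _ kP] := near_infty_natSinv_lt (PosNum (divr_gt0 d0 r0)).
  apply: le_trans (Wy k) _; rewrite lee_fin mulrC -ler_pdivlMr//.
  exact: ltW (kP k (leqnn k)).
have /nbhs_ballP[d d0 dP] := W_nbhs0 s s0.
exists d => // x xd k; apply: sP.
have : (W x <= s%:E)%E by apply: dP; rewrite -ball_normE /= sub0r normrN.
by elim: k => //= k IH /IH; exact: le_trans.
Qed.

(** * Assembly, with [W] as Lyapunov function *)

Theorem theorem5 (R : realType) (n m : nat)
  (f : 'rV[R]_n -> 'rV[R]_m -> 'rV[R]_n)
  (h : 'rV[R]_n -> 'rV[R]_m)
  (Omega : set 'rV[R]_n)
  (U : 'rV[R]_n -> bool -> R)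
  (w : 'rV[R]_n -> bool)
  (f_cont : continuous (fun p : 'rV[R]_n * 'rV[R]_m => f p.1 p.2))
  (f_00 : f 0 0 = 0)
  (Omega_compact : compact Omega)
  (Omega_nbhs0 : nbhs (0 : 'rV[R]_n) Omega)
  (U_cost : running_cost U)
  (h_cont : continuous h)
  (h_adm : admissible_control f U Omega h)
  (only_origin : forall S : set 'rV[R]_n,
      zero_cost_invariant (mode f h) U S -> S `<=` [set 0])
  (w_adm : admissible_policy (mode f h) U Omega w)
  (i : nat)
  (vi : 'rV[R]_n -> bool)
  (vi_argmin : argmin_policy (value_iteration (mode f h) U w i) vi)
  (r : R)
  (r_gt0 : 0 < r)
  (r_sub : value_sublevel (value_iteration (mode f h) U w i) vi r `<=` Omega) :
  [/\ asymptotically_stable (closed_loop (mode f h) vi),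
      compact (value_sublevel (value_iteration (mode f h) U w i) vi r) &
      roa_estimate (closed_loop (mode f h) vi)
        (value_sublevel (value_iteration (mode f h) U w i) vi r)].
Proof.
have [U_ge0 U0 U_cont] := U_cost.
have F_cont v : continuous (mode f h v) by exact: continuous_mode.
have [h0 _ _ _] := h_adm.
have F0 v : mode f h v 0 = 0 by case: v; rewrite /mode ?h0.
set F := mode f h in F_cont F0 *.
set V := value_iteration F U w i.
set g := closed_loop F vi.
pose W x := V x (vi x).
have W_ge0 x : (0 <= W x)%E by exact: value_iteration_ge0.
have W_decr x : ((U x (vi x))%:E + W (g x) <= W x)%E.
  exact: argmin_value_decrease.
have W_g x : (W (g x) <= W x)%E.
  by apply: le_trans (W_decr x); rewrite leeDr// lee_fin.
have Omega_closed : closed Omega.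
  by apply: compact_closed => //; exact: norm_hausdorff.
have V_closed v s : s <= r -> closed [set x | (V x v <= s%:E)%E].
  apply: (closed_value_iteration_sublevel F_cont U_cont U_ge0 Omega_closed
    w_adm).
  move=> x u Vx; apply: r_sub; exact: le_trans (vi_argmin x u) Vx.
have W_closed s : s <= r -> closed [set x | (W x <= s%:E)%E].
  (* The selection [vi] may be discontinuous, but [W] is the minimum over both modes, so its
     sublevel set is a union of two closed sets. *)
  move=> sr; rewrite (_ : [set x | _] = [set x | (V x false <= s%:E)%E] `|`
      [set x | (V x true <= s%:E)%E]); last first.
    apply/seteqP; split=> x /=.
      by rewrite /W; case: (vi x); [right | left].
    by case; apply: le_trans; exact: vi_argmin.
  by apply: closedU; exact: V_closed.
have W_compact : compact [set x | (W x <= r%:E)%E].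
  exact: subclosed_compact (W_closed r (lexx r)) Omega_compact r_sub.
have W_nbhs0 s : 0 < s -> nbhs (0 : 'rV[R]_n) [set x | (W x <= s%:E)%E].
  move=> s0; have Omega0 := nbhs_singleton Omega_nbhs0.
  (* Either mode would do: [W] is below the initial value function in that mode, which is continuous
     within [Omega] and vanishes at 0. *)
  have [_ /subspace_continuousP/(_ _ Omega0) V0_cont] := w_adm false.
  have near_lt : nbhs (0 : 'rV[R]_n)
      (fun x => Omega x -> (policy_value F U w x false < s%:E)%E).
    have /V0_cont// : nbhs (policy_value F U w 0 false) [set y | (y < s%:E)%E].
    apply: open_nbhs_nbhs; split; first exact: open_ereal_lt_ereal.
    by rewrite /= policy_value0.
  apply: filterS2 near_lt Omega_nbhs0 => x /[apply] /ltW V0s /=.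
  apply: le_trans (vi_argmin x false) _.
  exact: le_trans (value_iteration_le _ _ _ U_ge0) V0s.
have W_def x : (W x <= 0)%E -> x = 0.
  apply: (only_origin [set x | (W x <= 0)%E]) => {}x /= Wx.
  exists (vi x); split; last exact: le_trans (W_g x) Wx.
  apply/eqP; rewrite eq_le U_ge0 andbT -lee_fin.
  by apply: le_trans Wx; apply: le_trans (W_decr x); rewrite leeDl.
have roaW : roa_estimate g [set x | (W x <= r%:E)%E].
  apply: (roa_of_stage_cost0 F_cont U_cont U_ge0 only_origin) => //.
  - exact: W_nbhs0.
  - by move=> x /=; exact: le_trans.
  - move=> x /= Wx; apply: (cvg_stage_cost0 (c := fun y => U y (vi y)) _ W_ge0)
      => //.
    exact: le_lt_trans Wx (ltry r).
split=> //; split.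
  exact: lyapunov_stable_of_sublevels r_gt0 W_closed W_compact W_nbhs0 W_g
    W_def.
have /nbhs_ballP[d d0 dP] := W_nbhs0 r r_gt0.
exists d => // x /= xd; apply: roaW; apply: dP.
by rewrite -ball_normE /= sub0r normrN.
Qed.
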